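(* Let ${}^\bullet\mathbb{R}$ be the ring of Fermat reals with Giordano's order $\le$. For distinct $x,y\in{}^\bullet\mathbb{R}$, define $x<_F y$ if and only if at least one of the following holds: (i) there exists $l\in{}^\bullet\mathbb{R}$ such that $x\in\{k\in{}^\bullet\mathbb{R}: k\le l\}$ and $y\notin\{k\in{}^\bullet\mathbb{R}: k\le l\}$; (ii) $x=\max\{k\in{}^\bullet\mathbb{R}: k\le l\}$ for some $l\in{}^\bullet\mathbb{R}$, and there exists $h\in{}^\bullet\mathbb{R}$ with $h>0$ and $y=x+h$; (iii) $y=\min\{k\in{}^\bullet\mathbb{R}: l\le k\}$ for some $l\in{}^\bullet\mathbb{R}$, and there exists $h\in{}^\bullet\mathbb{R}$ with $h>0$ and $x=y-h$. Then the pair $({}^\bullet\mathbb{R},<_F)$ is a linearly ordered set.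
   Context: A little-oh polynomial is a function $x:\mathbb{R}_{\ge 0}\to\mathbb{R}$, $t\mapsto x_t$, such that $x_t=r+\sum_{i=1}^k\alpha_i t^{a_i}+o(t)$ as $t\to0^+$, for some $k\in\mathbb{N}$, $r,\alpha_1,\dots,\alpha_k\in\mathbb{R}$ and $a_1,\dots,a_k\in\mathbb{R}_{\ge0}$. The set of all little-oh polynomials is denoted $\mathbb{R}_o[t]$. For $x,y\in\mathbb{R}_o[t]$ put $x\sim y$ (also written ''$x=y$ in ${}^\bullet\mathbb{R}$'') if and only if $x_t=y_t+o(t)$ as $t\to0^+$. This is an equivalence relation, and the ring of Fermat reals is ${}^\bullet\mathbb{R}:=\mathbb{R}_o[t]/\sim$, with addition and multiplication induced by the pointwise operations. Giordano's order on ${}^\bullet\mathbb{R}$: for $x,y\in{}^\bullet\mathbb{R}$ (identified with representatives $x_t,y_t$), $x\le y$ if and only if there exists a little-oh polynomial $z$ with $z=0$ in ${}^\bullet\mathbb{R}$ (i.e. $\lim_{t\to0^+}z_t/t=0$) such that $x_t\le y_t+z_t$ for every sufficiently small $t\ge0$. This does not depend on the choice of representatives. The strict relation $a<b$ (equivalently $b>a$) means $a\le b$ and $a\ne b$ in ${}^\bullet\mathbb{R}$. The maxima and minima in the definition of $<_F$ are taken with respect to $\le$. The relation $<_F$ is a strict relation (it is defined only between distinct elements); ''linearly ordered set'' means that $<_F$ is a strict linear (total) order: irreflexive, transitive, and any two distinct elements are comparable. *)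

(* Defs.v *)
From HB Require Import structures.
From mathcomp Require Import all_boot all_order all_algebra.
From mathcomp Require Import generic_quotient ring_quotient.
From mathcomp Require Import interval_inference.
From mathcomp Require Import all_classical all_reals all_analysis.
Import Order.TTheory GRing.Theory Num.Theory.
Import numFieldNormedType.Exports.

Set Implicit Arguments.
Unset Strict Implicit.
Unset Printing Implicit Defensive.

Local Open Scope classical_set_scope.
Local Open Scope quotient_scope.
Local Open Scope ring_scope.

(* Pointedness of the domain gives the functions [{nonneg R} -> R] their pointwise
   ring structure.  The instance must be keyed on [Itv.def], to which [{nonneg R}]
   unfolds. *)
HB.instance Definition _ (R : realType) :=
  isPointed.Build (Itv.def (@Itv.num_sem R) (Itv.Real `[0%Z, +oo[)) 0%:nng.

Definition nonneg_abs (R : realType) (t : R) : {nonneg R} :=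
  NngNum (normr_ge0 t).

(* [w = o(t)] as t -> 0+.  A limit at [0^'+] only looks at t > 0, where
   [nonneg_abs t] is t itself, as an element of [{nonneg R}]. *)
Definition little_o_t (R : realType) (w : {nonneg R} -> R) : Prop :=
  w (nonneg_abs t) / t @[t --> 0^'+] --> (0 : R).

Definition little_oh_polynomial (R : realType) (x : {nonneg R} -> R) : Prop :=
  exists (r : R) (k : nat) (alpha a : 'I_k -> R),
    (forall i, 0 <= a i) /\
    little_o_t (fun t => x t - (r + \sum_(i < k) alpha i * t%:num `^ a i)).

Section LittleO.
Variable R : realType.
Implicit Types (w x y : {nonneg R} -> R) (s : seq (R * R)).

Lemma nonneg_absE (t : R) : 0 < t -> (nonneg_abs t)%:num = t.
Proof. by move=> t0; rewrite /= gtr0_norm. Qed.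

Lemma little_o_tP w : little_o_t w <->
  forall e : R, 0 < e -> \forall t \near 0^'+, `|w (nonneg_abs t)| <= e * t.
Proof.
split=> [/cvgrPdist_le h e e0|h].
  have := h e e0; apply: filterS2 (nbhs_right_gt (0 : R)) => t t0.
  by rewrite sub0r normrN normrM normfV (gtr0_norm t0) ler_pdivrMr.
apply/cvgrPdist_le => e e0.
have := h e e0; apply: filterS2 (nbhs_right_gt (0 : R)) => t t0.
by rewrite sub0r normrN normrM normfV (gtr0_norm t0) ler_pdivrMr.
Qed.

Lemma little_o_t0 : little_o_t (0 : {nonneg R} -> R).
Proof.
apply/little_o_tP => e e0; apply: filterS (nbhs_right_gt (0 : R)) => t t0.
by rewrite /= normr0 mulr_ge0 // ltW.
Qed.

Lemma little_o_tN w : little_o_t w -> little_o_t (- w).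
Proof.
move=> /little_o_tP h; apply/little_o_tP => e /h; apply: filterS => t.
by rewrite /= normrN.
Qed.

Lemma little_o_tD w w' : little_o_t w -> little_o_t w' -> little_o_t (w + w').
Proof.
move=> /little_o_tP h /little_o_tP h'; apply/little_o_tP => e e0.
have e20 : 0 < e / 2 by rewrite divr_gt0.
apply: filterS2 (h _ e20) (h' _ e20) => t ht ht'.
by rewrite (le_trans (ler_normD _ _))// [e]splitr mulrDl lerD.
Qed.

Definition bounded0 w := exists2 M : R, 0 < M &
  \forall t \near 0^'+, `|w (nonneg_abs t)| <= M.

Lemma little_o_tM b w : bounded0 b -> little_o_t w -> little_o_t (b * w).
Proof.
move=> [M M0 hb] /little_o_tP h; apply/little_o_tP => e e0.
have eM : 0 < e / M by rewrite divr_gt0.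
apply: filterS2 hb (h _ eM) => t hb ht.
rewrite /= normrM (le_trans (ler_pM _ _ hb ht))//.
by rewrite mulrA mulrCA divff ?mulr1 ?gt_eqF.
Qed.

Lemma little_o_t_bounded w : little_o_t w -> bounded0 w.
Proof.
move=> /little_o_tP /(_ 1 ltr01) h; exists 1 => //.
apply: filterS2 h (nbhs_right_lt (ltr01 : (0 : R) < 1)) => t ht t1.
by rewrite (le_trans ht)// mul1r ltW.
Qed.

Lemma bounded0D w w' : bounded0 w -> bounded0 w' -> bounded0 (w + w').
Proof.
move=> [M M0 h] [M' M0' h']; exists (M + M'); first exact: addr_gt0.
apply: filterS2 h h' => t h h'.
by rewrite (le_trans (ler_normD _ _))// lerD.
Qed.

Lemma little_o_t_eq w w' : (forall t : {nonneg R}, 0 < t%:num -> w t = w' t) ->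
  little_o_t w -> little_o_t w'.
Proof.
move=> ww' /little_o_tP h; apply/little_o_tP => e /h.
apply: filterS2 (nbhs_right_gt (0 : R)) => t t0.
by rewrite ww' // nonneg_absE.
Qed.

Definition polyt s : {nonneg R} -> R :=
  fun t => \sum_(c <- s) c.1 * t%:num `^ c.2.

Lemma polyt_bounded s : all (fun c => 0 <= c.2) s -> bounded0 (polyt s).
Proof.
elim: s => [_|c s ih /= /andP[c0 /ih h]].
  by exists 1 => //; apply: nearW => t; rewrite /polyt big_nil normr0.
have -> : polyt (c :: s) = (fun t => c.1 * t%:num `^ c.2) + polyt s.
  by apply/funext => t; rewrite /polyt big_cons.
apply: bounded0D => //; exists (`|c.1| + 1); first by rewrite ltr_wpDl.
apply: filterS2 (nbhs_right_gt (0 : R)) (nbhs_right_lt (ltr01 : (0 : R) < 1)).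
move=> t t0 t1; rewrite [X in `|X|](_ : _ = c.1 * t `^ c.2).
  rewrite normrM (ger0_norm (powR_ge0 _ _)).
  have : t `^ c.2 <= 1.
    rewrite -[leRHS](congr1 (@^~ c.2) (powR1 R)).
    by apply: ge0_ler_powR; rewrite ?nnegrE// ltW.
  move=> /(ler_wpM2l (normr_ge0 c.1)); rewrite mulr1 => /le_trans; apply.
  by rewrite lerDl.
by rewrite -[in RHS](nonneg_absE t0).
Qed.

Lemma little_oh_polynomialP x : little_oh_polynomial x <->
  exists2 s, all (fun c => 0 <= c.2) s & little_o_t (x - polyt s).
Proof.
split=> [[r [k [al [a [a0 h]]]]]|[s s0 h]].
  exists ((r, 0) :: [seq (al i, a i) | i <- index_enum 'I_k]).
    by rewrite /= lexx; apply/allP => c /mapP[i _ ->] /=.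
  apply: little_o_t_eq h => t _.
  rewrite -[RHS]/(x t - polyt _ t) /polyt.
  by rewrite big_cons big_map /= powRr0 mulr1.
exists 0, (size s), (fun i => (nth (0, 0) s i).1),
  (fun i => (nth (0, 0) s i).2); split.
  by move=> i; exact: (allP s0 _ (mem_nth _ (ltn_ord i))).
apply: little_o_t_eq h => t _ /=.
by rewrite -[LHS]/(x t - polyt s t) /polyt add0r (big_nth (0, 0)) big_mkord.
Qed.

Lemma little_oh_polynomial_subring :
  subring_closed [pred x : {nonneg R} -> R | `[< little_oh_polynomial x >] ].
Proof.
split.
- apply/asboolP/little_oh_polynomialP; exists [:: (1, 0)] => /=.
    by rewrite lexx.
  apply: little_o_t_eq little_o_t0 => t _.
  rewrite -[LHS]/(0 : R) -[RHS]/(1 - polyt _ t).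
  by rewrite /polyt big_seq1 /= powRr0 mulr1 subrr.
- move=> x y /asboolP/little_oh_polynomialP[s s0 xs].
  move=> /asboolP/little_oh_polynomialP[s' s'0 ys].
  apply/asboolP/little_oh_polynomialP.
  exists (s ++ [seq (- c.1, c.2) | c <- s']).
    rewrite all_cat s0; apply/allP => c /mapP[d ds ->] /=.
    exact: (allP s'0 _ ds).
  apply: little_o_t_eq (little_o_tD xs (little_o_tN ys)) => t _.
  rewrite -[LHS]/(x t - polyt s t - (y t - polyt s' t)).
  rewrite -[RHS]/(x t - y t - polyt _ t).
  have -> : polyt (s ++ [seq (- c.1, c.2) | c <- s']) t =
      polyt s t - polyt s' t.
    rewrite /polyt big_cat big_map /= -sumrN; congr (_ + _).
    by apply: eq_bigr => c _; rewrite mulNr.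
  by rewrite !opprD !opprK addrACA.
- move=> x y /asboolP/little_oh_polynomialP[s s0 xs].
  move=> /asboolP/little_oh_polynomialP[s' s'0 ys].
  apply/asboolP/little_oh_polynomialP.
  exists [seq (c.1 * d.1, c.2 + d.2) | c <- s, d <- s'].
    apply/allP => c /allpairsP[[d d'] [ds ds' ->]] /=.
    by rewrite addr_ge0// ?(allP s0 _ ds)// (allP s'0 _ ds').
  have yb : bounded0 y.
    rewrite -(subrK (polyt s') y); apply: bounded0D.
      exact: little_o_t_bounded.
    exact: polyt_bounded.
  have := little_o_tD (little_o_tM yb xs) (little_o_tM (polyt_bounded s0) ys).
  apply: little_o_t_eq => t t0.
  rewrite -[LHS]/(y t * (x t - polyt s t) + polyt s t * (y t - polyt s' t)).
  rewrite -[RHS]/(x t * y t - polyt _ t).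
  have -> : polyt [seq (c.1 * d.1, c.2 + d.2) | c <- s, d <- s'] t =
      polyt s t * polyt s' t.
    rewrite /polyt big_allpairs_dep mulr_suml; apply: eq_bigr => c _.
    rewrite mulr_sumr; apply: eq_bigr => d _ /=.
    rewrite (@powRD _ t%:num c.2 d.2) ?(gt_eqF t0) ?implybT//.
    by rewrite mulrACA.
  by rewrite !mulrBr addrA (mulrC (y t)) (mulrC (y t)) subrK.
Qed.

End LittleO.

(* The ring of little-oh polynomials, as a subring of the functions. *)
Definition lopoly_pred (R : realType) : {pred {nonneg R} -> R} :=
  [pred x | `[< little_oh_polynomial x >] ].

HB.instance Definition _ (R : realType) :=
  GRing.isSubringClosed.Build ({nonneg R} -> R) (@lopoly_pred R)
    (@little_oh_polynomial_subring R).

Record lopoly (R : realType) := LOPoly {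
  lopoly_fun :> {nonneg R} -> R;
  lopoly_funP : lopoly_fun \in @lopoly_pred R }.

HB.instance Definition _ (R : realType) := [isSub for @lopoly_fun R].
HB.instance Definition _ (R : realType) := [Choice of lopoly R by <:].
HB.instance Definition _ (R : realType) :=
  [SubChoice_isSubComNzRing of lopoly R by <:].

(* The ideal of the x with x_t = o(t); x ~ y iff x - y lies in it. *)
Definition lopoly_null (R : realType) : {pred lopoly R} :=
  [pred x : lopoly R | `[< little_o_t x >] ].

Section Ideal.
Variable R : realType.

Lemma lopoly_bounded (x : lopoly R) : bounded0 x.
Proof.
have /asboolP/little_oh_polynomialP[s s0 xs] := lopoly_funP x.
rewrite -(subrK (polyt s) (x : _ -> _)); apply: bounded0D.
  exact: little_o_t_bounded.
exact: polyt_bounded.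
Qed.

Lemma lopoly_null_idealr : idealr_closed (@lopoly_null R).
Proof.
split.
- by apply/asboolP; exact: little_o_t0.
- apply/asboolP => /little_o_tP /(_ 1 ltr01) h.
  have : \forall t \near (0 : R)^'+, False.
    apply: filterS2 h (nbhs_right_lt (ltr01 : (0 : R) < 1)) => t /=.
    by rewrite normr1 mul1r => /le_lt_trans h /h; rewrite ltxx.
  by move=> /filter_ex[].
- move=> a u v /asboolP hu /asboolP hv; apply/asboolP.
  by apply: little_o_tD hv; apply: little_o_tM hu; exact: lopoly_bounded.
Qed.

End Ideal.

HB.instance Definition _ (R : realType) :=
  isIdealr.Build (lopoly R) (@lopoly_null R) (@lopoly_null_idealr R).

Definition fermat (R : realType) : Type := {ideal_quot @lopoly_null R}.
HB.instance Definition _ (R : realType) :=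
  Choice.copy (fermat R) {ideal_quot @lopoly_null R}.
HB.instance Definition _ (R : realType) :=
  EqQuotient.copy (fermat R) {ideal_quot @lopoly_null R}.
HB.instance Definition _ (R : realType) :=
  GRing.ComNzRing.copy (fermat R) {ideal_quot @lopoly_null R}.

Lemma fermat_eqP (R : realType) (x y : lopoly R) :
  \pi_(fermat R) x = \pi_(fermat R) y <-> little_o_t (fun t => x t - y t).
Proof.
rewrite (rwP eqP) -[_ == _](Quotient.idealrBE (@lopoly_null R)).
by split => [/asboolP|] //; move=> h; apply/asboolP.
Qed.

(* Giordano's order on representatives. *)
Definition lopoly_le (R : realType) (x y : lopoly R) : Prop :=
  exists2 z : lopoly R, \pi_(fermat R) z = 0 &
    exists2 d : R, 0 < d &
      forall t : {nonneg R}, t%:num < d -> x t <= y t + z t.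

Definition fermat_le (R : realType) (x y : fermat R) : bool :=
  `[< lopoly_le (repr x) (repr y) >].

Section Order.
Variable R : realType.
Implicit Types (x y z : lopoly R).

Lemma fermat0P z : \pi_(fermat R) z = 0 <-> little_o_t z.
Proof.
have -> : (0 : fermat R) = \pi_(fermat R) 0.
  by rewrite -[RHS]/(\pi_{ideal_quot @lopoly_null R} 0) rmorph0.
rewrite fermat_eqP (_ : (fun t => _) = z :> (_ -> _))//.
by apply/funext => t; rewrite /= subr0.
Qed.

Lemma lopoly_le_refl x : lopoly_le x x.
Proof.
exists 0; first by apply/fermat0P; exact: little_o_t0.
by exists 1 => // t _; rewrite /= addr0.
Qed.

Lemma lopoly_le_trans y x z : lopoly_le x y -> lopoly_le y z -> lopoly_le x z.
Proof.
move=> [u /fermat0P u0 [d d0 h]] [v /fermat0P v0 [e e0 k]].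
exists (v + u); first by apply/fermat0P; exact: little_o_tD.
exists (Num.min d e); first by rewrite lt_min d0.
move=> t; rewrite lt_min => /andP[/h hd /k he].
by rewrite (le_trans hd)//= addrA lerD2r.
Qed.

Lemma lopoly_le_anti x y : lopoly_le x y -> lopoly_le y x ->
  \pi_(fermat R) x = \pi_(fermat R) y.
Proof.
move=> [u /fermat0P /little_o_tP u0 [d d0 h]].
move=> [v /fermat0P /little_o_tP v0 [e e0 k]].
apply/fermat_eqP/little_o_tP => r r0.
have := (u0 r r0, v0 r r0) => -[ur vr].
near=> t.
have t0 : 0 < t by near: t; exact: nbhs_right_gt.
have td : (nonneg_abs t)%:num < d.
  by rewrite nonneg_absE//; near: t; exact: nbhs_right_lt.
have te : (nonneg_abs t)%:num < e.
  by rewrite nonneg_absE//; near: t; exact: nbhs_right_lt.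
rewrite ler_norml; apply/andP; split.
  rewrite lerNl opprB lerBlDl (le_trans (k _ te))// lerD2l.
  by rewrite (le_trans (ler_norm _))//; near: t.
rewrite lerBlDl (le_trans (h _ td))// lerD2l.
by rewrite (le_trans (ler_norm _))//; near: t.
Unshelve. all: by end_near.
Qed.

Lemma lopoly_le_eq x y : \pi_(fermat R) x = \pi_(fermat R) y -> lopoly_le x y.
Proof.
move=> /fermat_eqP xy; exists (x - y); first exact/fermat0P.
by exists 1 => // t _; rewrite /= addrC subrK.
Qed.

(* Independence of the choice of representatives. *)
Lemma fermat_le_pi x y :
  fermat_le (\pi_(fermat R) x) (\pi_(fermat R) y) <-> lopoly_le x y.
Proof.
have e z : \pi_(fermat R) (repr (\pi_(fermat R) z)) = \pi_(fermat R) z.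
  by rewrite reprK.
split=> [/asboolP h|h].
  apply: lopoly_le_trans (lopoly_le_eq (esym (e x))) _.
  exact: lopoly_le_trans h (lopoly_le_eq (e y)).
apply/asboolP; apply: lopoly_le_trans (lopoly_le_eq (e x)) _.
exact: lopoly_le_trans h (lopoly_le_eq (esym (e y))).
Qed.

Lemma fermat_le_refl : reflexive (@fermat_le R).
Proof. by move=> x; apply/asboolP; exact: lopoly_le_refl. Qed.

Lemma fermat_le_anti : antisymmetric (@fermat_le R).
Proof.
move=> x y /andP[/asboolP xy /asboolP yx].
by rewrite -[x]reprK -[y]reprK; exact: lopoly_le_anti.
Qed.

Lemma fermat_le_trans : transitive (@fermat_le R).
Proof.
move=> y x z /asboolP xy /asboolP yz; apply/asboolP.
exact: lopoly_le_trans xy yz.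
Qed.

End Order.

(* The derived strict order is [(a < b) = (b != a) && (a <= b)]. *)
HB.instance Definition _ (R : realType) :=
  Order.Le_isPOrder.Build ring_display (fermat R)
    (@fermat_le_refl R) (@fermat_le_anti R) (@fermat_le_trans R).

Definition is_max d (T : porderType d) (A : set T) (x : T) : Prop :=
  A x /\ ubound A x.

Definition is_min d (T : porderType d) (A : set T) (x : T) : Prop :=
  A x /\ lbound A x.

Definition ltF (R : realType) (x y : fermat R) : Prop :=
  x <> y /\
  [\/ exists l : fermat R,
        x \in [set k | k <= l] /\ y \notin [set k | k <= l],
      (exists l : fermat R, is_max [set k | k <= l] x) /\
        (exists h : fermat R, 0 < h /\ y = x + h)
    | (exists l : fermat R, is_min [set k | l <= k] y) /\
        (exists h : fermat R, 0 < h /\ x = y - h)].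

Definition strict_linear_order (T : Type) (r : T -> T -> Prop) : Prop :=
  [/\ forall x, ~ r x x,
      forall x y z, r x y -> r y z -> r x z
    & forall x y, x <> y -> r x y \/ r y x].

(* Main.v *)
(* Near 0+ a finite sum of real powers of t has constant sign, so Giordano's
   order is total; it is also translation invariant.  Hence (i) is equivalent to
   x < y (take l = x in one direction), while (ii) and (iii) each imply x < y:
   the relation <_F is the strict part of a total order. *)
Require Import Defs.
From HB Require Import structures.
From mathcomp Require Import all_boot all_order all_algebra.
From mathcomp Require Import generic_quotient ring_quotient.
From mathcomp Require Import interval_inference.
From mathcomp Require Import all_classical all_reals all_analysis.

Import Order.TTheory GRing.Theory Num.Theory.
Import numFieldNormedType.Exports.

Set Implicit Arguments.
Unset Strict Implicit.
Unset Printing Implicit Defensive.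

Local Open Scope classical_set_scope.
Local Open Scope quotient_scope.
Local Open Scope ring_scope.

Section Polyt.
Variable R : realType.
Implicit Types (s : seq (R * R)) (t : {nonneg R}).

Lemma polyt_cons c s t : polyt (c :: s) t = c.1 * t%:num `^ c.2 + polyt s t.
Proof. by rewrite /polyt big_cons. Qed.

Lemma near0_powR_le (a e : R) : 0 < a -> 0 < e ->
  \forall t \near 0^'+, t `^ a <= e.
Proof.
move=> a0 e0.
(* The threshold is the point where the increasing function t^a reaches [e]. *)
have d0 : 0 < e `^ a^-1 by rewrite powR_gt0.
apply: filterS2 (nbhs_right_gt (0 : R)) (nbhs_right_lt d0) => t t0 td.
rewrite -[leRHS](powRr1 (ltW e0)) -(mulVf (lt0r_neq0 a0)) powRrM.
by rewrite ge0_ler_powR ?nnegrE ?powR_ge0// ltW.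
Qed.

(** Factoring t^a out of each term leaves a positive power of t, which tends to 0; along the list,
    half of [e] goes to the head and half to the tail. *)
Lemma polyt_little_o_powR s (a e : R) : all (fun c => a < c.2) s -> 0 < e ->
  \forall t \near 0^'+, `|polyt s (nonneg_abs t)| <= e * t `^ a.
Proof.
elim: s e => [|c s ih] e /= => [_ e0|/andP[ac sa] e0].
  by apply: nearW => t; rewrite /polyt big_nil normr0 mulr_ge0 ?powR_ge0 ?ltW.
have e20 : 0 < e / 2 by rewrite divr_gt0.
(* Adding 1 keeps this future divisor positive when [c.1] is zero. *)
have k0 : 0 < `|c.1| + 1 by rewrite ltr_wpDl.
have ac0 : 0 < c.2 - a by rewrite subr_gt0.
near=> t.
have t0 : 0 < t by near: t; exact: nbhs_right_gt.
rewrite polyt_cons nonneg_absE// (le_trans (ler_normD _ _))//.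
rewrite [e]splitr mulrDl lerD//; last by near: t; exact: ih.
rewrite -{1}(subrK a c.2) powRD ?(gt_eqF t0) ?implybT// mulrA normrM.
rewrite (ger0_norm (powR_ge0 t a)) ler_wpM2r ?powR_ge0// normrM.
rewrite (ger0_norm (powR_ge0 _ _)).
have h : t `^ (c.2 - a) <= e / 2 / (`|c.1| + 1).
  by near: t; apply: near0_powR_le => //; rewrite divr_gt0.
rewrite (le_trans (ler_wpM2l _ h))// mulrCA -[leRHS]mulr1 ler_wpM2l ?ltW//.
by rewrite ltr_pdivrMr// mul1r ltrDl.
Unshelve. all: by end_near.
Qed.

(** Isolates the leading term when [a] is the least exponent. Exponents may repeat in [s], so the
    leading coefficient is a sum and can vanish. *)
Lemma polyt_split s (a : R) t : all (fun c => a <= c.2) s ->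
  polyt s t = (\sum_(c <- s | c.2 == a) c.1) * t%:num `^ a +
              polyt [seq c <- s | a < c.2] t.
Proof.
move=> /allP sa; rewrite /polyt big_filter (bigID (fun c => c.2 == a)) /=.
rewrite mulr_suml; congr (_ + _); first by apply: eq_bigr => c /eqP ->.
(* The bound [a <= c.2] holds only for members of [s], so membership is carried into the index
   condition. *)
rewrite big_seq_cond [RHS]big_seq_cond; apply: eq_bigl => c.
by case: (boolP (c \in s)) => //= /sa ac; rewrite lt_neqAle ac andbT eq_sym.
Qed.

Lemma seq_min_exponent s : s != [::] ->
  exists2 c, c \in s & all (fun d => c.2 <= d.2) s.
Proof.
elim: s => // c s ih _.
have [->|/ih[m ms /allP mP]] := eqVneq s [::].
  by exists c; rewrite ?mem_head//= lexx.
have [cm|mc] := leP c.2 m.2.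
  exists c; rewrite ?mem_head//= lexx; apply/allP => d /mP.
  exact: le_trans.
by exists m; rewrite ?in_cons ?ms ?orbT//= (ltW mc); apply/allP.
Qed.

(* The coefficient of the least exponent decides the sign, unless the terms
   having that exponent cancel; in this case they can be dropped. *)
Lemma polyt_sign s :
  (\forall t \near (0 : R)^'+, 0 <= polyt s (nonneg_abs t)) \/
  (\forall t \near (0 : R)^'+, polyt s (nonneg_abs t) <= 0).
Proof.
(* Strong induction on the length, since a cancellation may drop several terms at once. *)
have [n] := ubnP (size s); elim: n s => // n ih s /ltnSE sn.
have [->|s0] := eqVneq s [::].
  by left; apply: nearW => t; rewrite /polyt big_nil.
have [m ms sm] := seq_min_exponent s0.
set a := m.2 in sm; set s' := [seq c <- s | a < c.2].
have s's : (size s' < size s)%N.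
  rewrite size_filter -(count_predC (fun c => a < c.2) s) -addn1 leq_add2l.
  by rewrite -has_count; apply/hasP; exists m => //=; rewrite ltxx.
pose k := \sum_(c <- s | c.2 == a) c.1.
have sE (t : R) : 0 < t -> polyt s (nonneg_abs t) =
    k * t `^ a + polyt s' (nonneg_abs t).
  by move=> t0; rewrite (polyt_split _ sm) nonneg_absE.
have s'o (e : R) : 0 < e ->
    \forall t \near 0^'+, `|polyt s' (nonneg_abs t)| <= e * t `^ a.
  by apply: polyt_little_o_powR; exact: filter_all.
have t0 := nbhs_right_gt (0 : R).
(* For nonzero [k] the remainder is eventually at most |k| t^a in absolute value, so it cannot
   overturn the sign of k t^a. *)
have [k0|k0|k0] := ltgtP k 0.
- right; apply: filterS2 t0 (s'o (- k) _); last by rewrite oppr_gt0.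
  move=> t t0; rewrite sE// mulNr => /(le_trans (ler_norm _)).
  by rewrite -lerBrDl sub0r.
- left; apply: filterS2 t0 (s'o k k0) => t t0.
  by rewrite sE// ler_norml => /andP[+ _]; rewrite lerNl -subr_ge0 opprK.
- case: (ih s' (leq_trans s's sn)) => h; [left|right];
    by apply: filterS2 t0 h => t t0; rewrite sE// k0 mul0r add0r.
Qed.

End Polyt.

Section FermatOrder.
Variable R : realType.

(** An empty sum of powers approximates [w]; hence any o(t) function can serve as the null term in
    Giordano's order. *)
Lemma little_o_t_lopoly (w : {nonneg R} -> R) : little_o_t w ->
  w \in @lopoly_pred R.
Proof.
move=> w0; apply/asboolP/little_oh_polynomialP; exists [::] => //.
apply: little_o_t_eq w0 => t _.
by rewrite -[RHS]/(w t - polyt _ t) /polyt big_nil subr0.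
Qed.

Lemma near_le_lopoly_le (x y : lopoly R) (w : {nonneg R} -> R) :
  little_o_t w ->
  (\forall t \near 0^'+,
     x (nonneg_abs t) <= y (nonneg_abs t) + w (nonneg_abs t)) ->
  lopoly_le x y.
Proof.
move=> w0 [d /= d0 xyw].
(* [lopoly_le] also constrains the value at [t = 0], which [w] need not do. *)
pose z t := if t%:num == 0 then x t - y t else w t.
have z0 : little_o_t z.
  by apply: little_o_t_eq w0 => t t0; rewrite /z gt_eqF.
exists (LOPoly (little_o_t_lopoly z0)); first exact/fermat0P.
exists d => // t td /=; rewrite /z.
have [_|tn0] := eqVneq t%:num 0; first by rewrite addrC subrK.
have t0 : 0 < t%:num by rewrite lt_neqAle eq_sym tn0 /=.
have <- : nonneg_abs t%:num = t by apply/val_inj; exact: nonneg_absE.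
by apply: xyw => //=; rewrite sub0r normrN gtr0_norm.
Qed.

(** Up to an o(t) remainder, x - y is a finite sum of powers, of constant sign near 0+; the
    remainder, up to sign, is the null term that the order allows. *)
Lemma lopoly_le_total (x y : lopoly R) : lopoly_le x y \/ lopoly_le y x.
Proof.
have /asboolP/little_oh_polynomialP[s _ xys] := lopoly_funP (x - y).
pose w t := x t - y t - polyt s t.
have {}xys : little_o_t w by apply: little_o_t_eq xys.
have [h|h] := polyt_sign s; [right|left].
  apply: near_le_lopoly_le (little_o_tN xys) _; apply: filterS h => t h.
  rewrite -[(- w) _]/(- w (nonneg_abs t)) /w !opprB addrCA.
  by rewrite [x _ + _]addrC subrK lerDr.
apply: near_le_lopoly_le xys _; apply: filterS h => t h.
by rewrite /w addrA addrCA subrr addr0 lerDl oppr_ge0.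
Qed.

Lemma fermat_le_total (x y : fermat R) : (x <= y) || (y <= x).
Proof.
by have [h|h] := lopoly_le_total (repr x) (repr y); apply/orP; [left|right];
  apply/asboolP.
Qed.

Lemma fermat_nle_lt (x y : fermat R) : ~~ (y <= x) -> x < y.
Proof.
move=> yx; have := fermat_le_total x y; rewrite (negbTE yx) orbF => xy.
by rewrite lt_neqAle xy andbT; apply: contraNneq yx => ->.
Qed.

(** On representatives, adding [x] to both sides of [0 <= h + z] keeps the same null [z]; strictness
    follows by cancelling [x]. *)
Lemma fermat_ltDl (x h : fermat R) : 0 < h -> x < x + h.
Proof.
rewrite !lt_neqAle => /andP[h0 hle]; apply/andP; split.
  apply: contraNneq h0 => /esym/eqP.
  by rewrite -subr_eq0 addrAC subrr add0r eq_sym.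
have piD (u v : lopoly R) :
    \pi_(fermat R) u + \pi_(fermat R) v = \pi_(fermat R) (u + v).
  by rewrite -[RHS]/(\pi_{ideal_quot @lopoly_null R} (u + v)) rmorphD.
have pi0 : 0 = \pi_(fermat R) 0.
  by rewrite -[RHS]/(\pi_{ideal_quot @lopoly_null R} 0) rmorph0.
move: hle; rewrite -[x]reprK -[h]reprK pi0 piD.
move=> /fermat_le_pi[z z0 [d d0 hd]]; apply/fermat_le_pi.
by exists z => //; exists d => // t /hd; rewrite /= -addrA lerDl.
Qed.

Lemma ltFE (x y : fermat R) : ltF x y <-> x < y.
Proof.
split=> [[_]|xy].
  move=> [[l []]|[_ [h [h0 ->]]]|[_ [h [h0 ->]]]].
  - rewrite inE notin_setE /= => xl /negP/fermat_nle_lt; exact: le_lt_trans.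
  - exact: fermat_ltDl.
  (* Writing y as (y - h) + h reduces clause (iii) to the inequality used for clause (ii). *)
  - by rewrite -[ltRHS](subrK h); exact: fermat_ltDl.
split; first by move=> e; rewrite e ltxx in xy.
apply: Or31; exists x; rewrite inE notin_setE /=; split=> // yx.
by have := lt_le_trans xy yx; rewrite ltxx.
Qed.

End FermatOrder.

Theorem theorem3p1 (R : realType) : strict_linear_order (@ltF R).
Proof.
split=> [x /ltFE|x y z /ltFE xy /ltFE yz|x y /eqP xy].
- by rewrite ltxx.
- by apply/ltFE; exact: lt_trans yz.
- have /orP[h|h] := fermat_le_total x y; [left|right]; apply/ltFE;
    by rewrite lt_neqAle h ?xy // eq_sym xy.
Qed.
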